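(* Consider $n$ agents $\dot x_i=A_ix_i+b_iu_i$, $A_i\in\mathbb{R}^{m_i\times m_i}$, $b_i\in\mathbb{R}^{m_i}$, $i=1,\dots,n$, interconnected over a weighted undirected graph $\mathbb{G}$ with symmetric adjacency matrix $(a_{ij})$, in which the leaders are the agents $i_1,\dots,i_r$, under the protocol $$u_i=-\alpha_i^TT_ix_i+\sum_{j\in N_i}a_{ij}\left(\beta_j^TT_jx_j-\beta_i^TT_ix_i\right)+u_{oi},\qquad i=1,\dots,n,$$ with feedback gains $\beta_i\in\mathbb{R}^{m_i}$ and $T_i,\alpha_i$ as specified in the context. This network is controllable if and only if the following two conditions are satisfied simultaneously: i) the matrix pairs $(A_i,b_i)$, $i=1,2,\dots,n$, are all controllable; ii) the interconnection topology $\mathbb{G}$ of the network is leader-follower connected.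
   Context: In a weighted undirected graph, $a_{ij}=a_{ji}>0$ if $i,j$ are adjacent and $a_{ij}=0$ otherwise (no self-loops); $N_i$ is the set of neighbors of $i$. The external input $u_{oi}$ is scalar; it is free if agent $i$ is a leader and $u_{oi}=0$ if agent $i$ is a follower (not a leader). $u_o$ is the vector of the external inputs of the leaders. $T_i$ and $\alpha_i$: if $(A_i,b_i)$ is controllable, $T_i\in\mathbb{R}^{m_i\times m_i}$ is the invertible matrix with $$T_iA_iT_i^{-1}=\begin{pmatrix}0_{m_i-1}&I_{m_i-1}\\ \alpha_{i1}&\tilde\alpha_i\end{pmatrix},\qquad T_ib_i=\begin{pmatrix}0_{m_i-1}\\1\end{pmatrix},$$ and $\alpha_i^T=(\alpha_{i1},\tilde\alpha_i)$ is the last row of $T_iA_iT_i^{-1}$. If $(A_i,b_i)$ is not controllable, with controllable subspace of dimension $c_i<m_i$, $T_i$ is an invertible matrix giving a controllability decomposition $$T_iA_iT_i^{-1}=\begin{pmatrix}\bar A_{ic}&\bar A_i\\0&\bar A_{i\bar c}\end{pmatrix},\qquad T_ib_i=\begin{pmatrix}\bar b_{ic}\\0\end{pmatrix},$$ with $\bar A_{ic}\in\mathbb{R}^{c_i\times c_i}$ a companion matrix as in the controllable case and $\bar b_{ic}$ the last column of $I_{c_i}$, and $\alpha_i^T$ consists of the last row of $\bar A_{ic}$ followed by zeros. Here $0_{k}$ is the zero column vector of length $k$. Controllability of the network: for any initial state $x(t_0)=x_0$ and any target state $x^*$ of the stacked state $x=(x_1^T,\dots,x_n^T)^T$, there exist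 a finite time $T>t_0$, a control input $u_o$, and gains $\beta_i\in\mathbb{R}^{m_i}$, $i=1,\dots,n$, such that $x(T)=x^*$. A pair $(A,b)$ is controllable if $\dot x=Ax+bu$ is controllable. A graph is leader-follower connected if each of its connected components contains at least one leader. *)

(* Defs.v *)
From mathcomp Require Export all_boot all_order all_algebra.
From mathcomp Require Export all_classical all_reals all_analysis.
Export numFieldNormedType.Exports.
Export Order.TTheory GRing.Theory Num.Theory.

Set Implicit Arguments.
Unset Strict Implicit.
Unset Printing Implicit Defensive.

Local Open Scope classical_set_scope.
Local Open Scope ring_scope.

(* Piecewise continuity on [t0, t1] in the usual sense: finitely many
   discontinuities, all of them with finite one-sided limits. *)
Definition piecewise_continuous (R : realType) (t0 t1 : R) (u : R -> R) : Prop :=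
  [/\ exists s : seq R,
        forall t, t0 < t < t1 -> t \notin s -> {for t, continuous u},
      forall t, t0 <= t < t1 -> cvg (u @ t^'+)
    & forall t, t0 < t <= t1 -> cvg (u @ t^'-)].

(* x' = f on [t0, t1].  As inputs may jump, x is continuous on the whole
   interval but the equation may fail at finitely many times. *)
Definition ode_solution (R : realType) (m : nat) (t0 t1 : R)
    (x f : R -> 'cV[R]_m) : Prop :=
  {within `[t0, t1], continuous x} /\
  exists s : seq R,
    forall t, t0 < t < t1 -> t \notin s -> is_derive t (1 : R) x (f t).

Definition steers (R : realType) (m : nat) (A : 'M[R]_m) (b : 'cV[R]_m)
    (t0 : R) (x0 xs : 'cV[R]_m) : Prop :=
  exists (t1 : R) (u : R -> R) (x : R -> 'cV[R]_m),
    [/\ t0 < t1, piecewise_continuous t0 t1 u,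
        ode_solution t0 t1 x (fun t => A *m x t + u t *: b),
        x t0 = x0 & x t1 = xs].

Definition controllable_pair (R : realType) (t0 : R) (m : nat)
    (A : 'M[R]_m) (b : 'cV[R]_m) : Prop :=
  forall x0 xs : 'cV[R]_m, steers A b t0 x0 xs.

(* The states reachable from the origin. *)
Definition controllable_subspace (R : realType) (t0 : R) (m : nat)
    (A : 'M[R]_m) (b : 'cV[R]_m) : set 'cV[R]_m :=
  [set xs | steers A b t0 0 xs].

(* S is a linear subspace of dimension c: the rows of V are a basis of it. *)
Definition has_dim (R : realType) (m : nat) (S : set 'cV[R]_m) (c : nat) : Prop :=
  exists V : 'M[R]_(c, m),
    row_free V /\ forall v : 'cV[R]_m, S v <-> (v^T <= V)%MS.

(* The matrix with first rows (0 I) and last row al^T; when m = 0 it is empty. *)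
Definition companion (R : realType) (m : nat) (al : 'cV[R]_m) : 'M[R]_m :=
  \matrix_(i, j) if i.+1 == m then al j 0 else ((j : nat) == i.+1)%:R.

(* The last column of the identity matrix; when m = 0 it is empty. *)
Definition last_vec (R : realType) (m : nat) : 'cV[R]_m :=
  \col_(i < m) (i.+1 == m)%:R.

Definition controllable_form (R : realType) (m : nat) (A : 'M[R]_m)
    (b : 'cV[R]_m) (T : 'M[R]_m) (al : 'cV[R]_m) : Prop :=
  [/\ T \in unitmx, T *m A *m invmx T = companion al & T *m b = last_vec R m].

(* c is the dimension of the controllable subspace, d = m - c > 0; the casts
   only identify 'I_(c + d) with 'I_m.  The case c = 0, i.e. b = 0, is included. *)
Definition uncontrollable_form (R : realType) (t0 : R) (m : nat) (A : 'M[R]_m)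
    (b : 'cV[R]_m) (T : 'M[R]_m) (al : 'cV[R]_m) : Prop :=
  T \in unitmx /\
  exists (c d : nat) (e : (c + d)%N = m) (alc : 'cV[R]_c)
         (Abar : 'M[R]_(c, d)) (Anc : 'M[R]_d),
    [/\ (c < m)%N /\ has_dim (controllable_subspace t0 A b) c,
        T *m A *m invmx T = castmx (e, e) (block_mx (companion alc) Abar 0 Anc),
        T *m b = castmx (e, erefl 1%N) (col_mx (last_vec R c) 0)
      & al = castmx (e, erefl 1%N) (col_mx alc 0)].

Definition transform_spec (R : realType) (t0 : R) (m : nat) (A : 'M[R]_m)
    (b : 'cV[R]_m) (T : 'M[R]_m) (al : 'cV[R]_m) : Prop :=
  (controllable_pair t0 A b -> controllable_form A b T al) /\
  (~ controllable_pair t0 A b -> uncontrollable_form t0 A b T al).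

(* Weighted undirected graphs without self-loops, as adjacency matrices;
   i and j are adjacent when a i j > 0. *)
Definition weighted_graph (R : realType) (n : nat) (a : 'M[R]_n) : Prop :=
  [/\ forall i j, a i j = a j i, forall i j, 0 <= a i j & forall i, a i i = 0].

Definition adjacent (R : realType) (n : nat) (a : 'M[R]_n) : rel 'I_n :=
  fun i j => 0 < a i j.

Definition neighbors (R : realType) (n : nat) (a : 'M[R]_n) (i : 'I_n) :
    {set 'I_n} := [set j | adjacent a i j]%SET.

Definition component (R : realType) (n : nat) (a : 'M[R]_n) (i : 'I_n) :
    {set 'I_n} := [set j | connect (adjacent a) i j]%SET.

Definition leader_follower_connected (R : realType) (n : nat) (a : 'M[R]_n)
    (leaders : {set 'I_n}) : Prop :=
  forall i : 'I_n, exists2 l, l \in leaders & l \in component a i.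

Definition dotv (R : realType) (m : nat) (u v : 'cV[R]_m) : R := (u^T *m v) 0 0.

(* The input u_i for the stacked state z and the external inputs w; only the
   entries of w at leaders matter. *)
Definition protocol (R : realType) (n : nat) (m : 'I_n -> nat) (a : 'M[R]_n)
    (leaders : {set 'I_n}) (T : forall i, 'M[R]_(m i))
    (al be : forall i, 'cV[R]_(m i)) (z : forall i, 'cV[R]_(m i))
    (w : 'I_n -> R) (i : 'I_n) : R :=
  - dotv (al i) (T i *m z i)
  + \sum_(j in neighbors a i)
      a i j * (dotv (be j) (T j *m z j) - dotv (be i) (T i *m z i))
  + (if i \in leaders then w i else 0).

(* A stacked state is a family of agent states.  The gains be come after the
   initial and target states and may depend on them. *)
Definition network_controllable (R : realType) (t0 : R) (n : nat)
    (m : 'I_n -> nat) (A : forall i, 'M[R]_(m i)) (b : forall i, 'cV[R]_(m i))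
    (a : 'M[R]_n) (leaders : {set 'I_n})
    (T : forall i, 'M[R]_(m i)) (al : forall i, 'cV[R]_(m i)) : Prop :=
  forall x0 xs : forall i, 'cV[R]_(m i),
  exists (t1 : R) (uo : 'I_n -> R -> R) (be : forall i, 'cV[R]_(m i))
         (x : forall i, R -> 'cV[R]_(m i)),
    [/\ t0 < t1,
        forall i, i \in leaders -> piecewise_continuous t0 t1 (uo i),
        forall i, ode_solution t0 t1 (x i) (fun t =>
          A i *m x i t
          + protocol a leaders T al be (x^~ t) (uo^~ t) i *: b i),
        forall i, x i t0 = x0 i
      & forall i, x i t1 = xs i].

(* Main.v *)
Require Import Defs.
From mathcomp Require Import ring lra.

(** In the coordinates z_i = T_i x_i of a controllable agent, the feedback
    - al_i^T T_i x_i cancels the last row of the companion matrix, so that agent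
    i becomes a chain of m_i integrators driven by
      v_i = \sum_j a_ij (y_j - y_i) + u_oi,   where y_i = be_i^T z_i.

    Necessity.  If (A_i, b_i) is not controllable, the trailing coordinates of
    T_i x_i obey a linear equation without input ([uncontrollable_annihilator]),
    so they stay at zero when they start there ([linear_ode_eq0]), whatever the
    gains.  If all the pairs are controllable but a connected component C has no
    leader, then the sum over C of the last coordinates of the z_i has derivative
    \sum_(i in C) v_i, which vanishes because the weights are symmetric: the sum
    is conserved, and targets with another value cannot be reached
    ([topology_necessary]).

    Sufficiency.  Gains of the form be_i = k_i e_1 suffice.  The set S of agents
    with k_i nonzero is grown from the empty set, one agent at a time: each new
    agent v is a leader or a neighbour of S.  The invariant is that the network
    becomes controllable when the agents outside S receive arbitrary inputs on
    all their coordinates.  When v loses its additional inputs while k_v is still 0,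
    suppose that a functional w annihilates the reachable space.  As v is a
    nilpotent chain which nobody listens to, w F^j is supported on S for large j,
    hence is zero by the invariant; so the last nonzero w F^j is an invariant
    functional, killed by F.  Its components p_i along the last coordinates are
    zero at the leaders and outside S and v, and harmonic on S for the graph
    Laplacian; by the minimum principle p = 0 ([harmonic_eq0]), and then the
    functional itself is zero ([kalman_extend]).  Controllability being an open
    condition, it survives a small change of k_v to a nonzero value
    ([kalman_perturb]), and S can be enlarged by v ([exists_gains]).

    It remains to steer a controllable linear system, which polynomial inputs and
    trajectories achieve ([polynomial_steering]).  One glues truncated Taylor series of the free
    motions through the two given states by a polynomial cutoff; the error
    vanishes to high order at both ends of the time interval, and Kalman's
    condition absorbs it without disturbing the end points ([krylov_solve]). *)

Set Implicit Arguments.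
Unset Strict Implicit.
Unset Printing Implicit Defensive.

Local Open Scope classical_set_scope.
Local Open Scope ring_scope.

Local Notation dmx := (map_mx (@deriv _)).
Local Notation cmx := (map_mx polyC).
Local Notation evmx t := (map_mx (horner_eval t)).

(** * Kalman's condition and its openness *)

(** Stated dually: no nonzero functional annihilates all the columns of the
    matrices A^j B.  Quantifying over all the exponents makes the set of
    annihilating functionals stable under A; by Cayley-Hamilton the condition
    is the same with the exponents below n. *)
Definition kalman (K : fieldType) (n r : nat) (A : 'M[K]_n) (B : 'M[K]_(n, r)) :=
  forall w : 'rV[K]_n, (forall j, w *m (A ^+ j) *m B = 0) -> w = 0.

Lemma krylov_finite (K : fieldType) (n r : nat) (A : 'M[K]_n)
    (B : 'M[K]_(n, r)) (w : 'rV[K]_n) :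
  (forall j, (j < n)%N -> w *m (A ^+ j) *m B = 0) ->
  forall j, w *m (A ^+ j) *m B = 0.
Proof.
case: n A B w => [|n] A B w H j; first by rewrite (thinmx0 w) !mul0mx.
have -> : A ^+ j = horner_mx A ('X^j %% char_poly A).
  have -> : A ^+ j = horner_mx A 'X^j by rewrite rmorphXn /= horner_mx_X.
  rewrite [in LHS](divp_eq 'X^j (char_poly A)).
  by rewrite rmorphD rmorphM /= Cayley_Hamilton mulr0 add0r.
set p := _ %% _.
have sp : (size p <= n.+1)%N.
  rewrite -ltnS -(size_char_poly A) ltn_modp.
  exact/monic_neq0/char_poly_monic.
rewrite -[p]coefK poly_def rmorph_sum /= mulmx_sumr mulmx_suml big1// => i _.
rewrite linearZ /= rmorphXn /= horner_mx_X -scalemxAr -scalemxAl.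
by rewrite H ?scaler0// (leq_trans (ltn_ord i)).
Qed.

(** Over a real field the invertibility of this matrix is equivalent to Kalman's
    condition, and its determinant is polynomial in A, which is what makes the
    condition open.  It is defined over any ring so as to apply also to matrices
    of polynomials. *)
Definition gramian (K : comPzRingType) (n r : nat) (A : 'M[K]_n)
    (B : 'M[K]_(n, r)) : 'M[K]_n :=
  \sum_(j < n) (A ^+ j *m B) *m (A ^+ j *m B)^T.

Lemma mulmx_tr_eq0 (K : realFieldType) (r : nat) (v : 'rV[K]_r) :
  (v *m v^T) 0 0 = 0 -> v = 0.
Proof.
rewrite mxE => /eqP; rewrite psumr_eq0 => [/allP H|i _]; last first.
  by rewrite mxE -expr2 sqr_ge0.
apply/rowP => i; rewrite mxE; have := H i (mem_index_enum _).
by rewrite mxE -expr2 sqrf_eq0 => /eqP.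
Qed.

Lemma mulmx_tr_ge0 (K : realFieldType) (r : nat) (v : 'rV[K]_r) :
  0 <= (v *m v^T) 0 0.
Proof. by rewrite mxE sumr_ge0// => i _; rewrite mxE -expr2 sqr_ge0. Qed.

(** A functional w in the kernel of the Gramian G satisfies
    0 = w G w^T = \sum_j |w A^j B|^2, so that it kills every A^j B. *)
Lemma kalman_gramian (K : realFieldType) (n r : nat) (A : 'M[K]_n)
    (B : 'M[K]_(n, r)) : kalman A B <-> gramian A B \in unitmx.
Proof.
split=> [kAB|uG w H]; last first.
  rewrite -[w]mulmx1 -(mulmxV uG) mulmxA mulmx_sumr big1 ?mul0mx// => j _.
  by rewrite !mulmxA H !mul0mx.
rewrite -row_free_unit -kermx_eq0; apply/eqP/row_matrixP => i.
rewrite row0; apply: kAB; set w := row i _.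
have wG : w *m gramian A B = 0.
  by apply/sub_kermxP; rewrite row_sub.
apply: krylov_finite => j jn; apply: mulmx_tr_eq0.
have : (w *m gramian A B *m w^T) 0 0 = 0 by rewrite wG mul0mx mxE.
rewrite mulmx_sumr mulmx_suml summxE => /eqP.
under eq_bigr => k _.
  have -> : w *m (A ^+ k *m B *m (A ^+ k *m B)^T) *m w^T
     = (w *m A ^+ k *m B) *m (w *m A ^+ k *m B)^T by rewrite !trmx_mul !mulmxA.
  over.
rewrite psumr_eq0 => [/allP /(_ (Ordinal jn) (mem_index_enum _)) /eqP //|k _].
exact: mulmx_tr_ge0.
Qed.

Lemma nonroot_neq0 (K : realFieldType) (p : {poly K}) :
  p != 0 -> exists2 e, e != 0 & ~~ root p e.
Proof.
move=> p0; pose s := [seq (i.+1)%:R : K | i <- iota 0 (size p)].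
have us : uniq s.
  by rewrite map_inj_uniq ?iota_uniq// => i j /eqP; rewrite eqr_nat => /eqP [].
have : ~~ all (root p) s.
  apply/negP => rs; have := max_poly_roots p0 rs us.
  by rewrite size_map size_iota ltnn.
by rewrite -has_predC => /hasP[e /mapP[i _ ->] re]; exists i.+1%:R.
Qed.

(** The determinant of the Gramian of A + e H is a polynomial in e; it does not
    vanish at 0, so it has only finitely many roots. *)
Lemma kalman_perturb (K : realFieldType) (n r : nat) (A H : 'M[K]_n)
    (B : 'M[K]_(n, r)) :
  kalman A B -> exists2 e, e != 0 & kalman (A + e *: H) B.
Proof.
move=> /kalman_gramian uG.
pose P := map_mx polyC A + 'X *: map_mx polyC H.
pose p := \det (gramian P (map_mx polyC B)).
have mapP e : map_mx (horner_eval e) P = A + e *: H.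
  by apply/matrixP => i j; rewrite !mxE /horner_eval !hornerE mulrC.
have mapB e : map_mx (horner_eval e) (map_mx polyC B) = B.
  by apply/matrixP => i j; rewrite !mxE /horner_eval hornerC.
have mapX e j : map_mx (horner_eval e) (P ^+ j) = (A + e *: H) ^+ j.
  elim: j => [|j IH]; first by rewrite !expr0 map_mx1.
  by rewrite !exprS -IH -mapP; exact: map_mxM.
have evp e : p.[e] = \det (gramian (A + e *: H) B).
  rewrite -[LHS]/(horner_eval e p) /p -det_map_mx; congr (\det _).
  rewrite /gramian raddf_sum /=; apply: eq_bigr => j _.
  by rewrite map_mxM -map_trmx map_mxM mapX mapB.
have p0 : p != 0.
  apply/eqP => p0; move: uG.
  by rewrite unitmxE unitfE -[A]addr0 -(scale0r H) -evp p0 horner0 eqxx.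
have [e e0 re] := nonroot_neq0 p0; exists e => //.
by apply/kalman_gramian; rewrite unitmxE unitfE -evp.
Qed.

(** * Polynomial steering *)

Lemma dmx_mul_cst (K : comNzRingType) (n p q : nat) (A : 'M[K]_(n, p))
    (X : 'M[{poly K}]_(p, q)) : dmx (cmx A *m X) = cmx A *m dmx X.
Proof.
apply/matrixP => i j; rewrite !mxE raddf_sum; apply: eq_bigr => k _.
by rewrite !mxE /= derivM derivC mul0r add0r.
Qed.

Lemma dmxZ (K : comNzRingType) (n p : nat) (c : {poly K})
    (X : 'M[{poly K}]_(n, p)) : dmx (c *: X) = c^`() *: X + c *: dmx X.
Proof. by apply/matrixP => i j; rewrite !mxE derivM. Qed.

Lemma dmx_expZ (K : comNzRingType) (n p e : nat) (c : {poly K})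
    (X : 'M[{poly K}]_(n, p)) :
  dmx (c ^+ e.+1 *: X) = c ^+ e *: ((e.+1%:R * c^`()) *: X + c *: dmx X).
Proof.
rewrite dmxZ deriv_exp /= scalerDr !scalerA exprSr; congr (_ *: _ + _).
by rewrite -mulr_natl; ring.
Qed.

Lemma dmx_cst (K : comNzRingType) (n p : nat) (x : 'M[K]_(n, p)) :
  dmx (cmx x) = 0.
Proof. by apply/matrixP => i j; rewrite !mxE derivC. Qed.

(** Solves h' = A h + B u - A^j B w, where w = d^(e+j) v, by a function h that is
    still divisible by d^e: since (d/dt - A) (A^j B w) = A^j B w' - A^(j+1) B w,
    the right-hand side A^(j+1) B w can be traded for A^j B w', and each of these
    trades costs one derivative of w, hence one power of d. *)
Lemma krylov_solve (K : comNzRingType) (n r : nat) (A : 'M[K]_n)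
    (B : 'M[K]_(n, r)) (d : {poly K}) (j e : nat) (v : 'cV[{poly K}]_r) :
  exists (h : 'cV[{poly K}]_n) (u : 'cV[{poly K}]_r),
    dmx (d ^+ e *: h) = cmx A *m (d ^+ e *: h) + cmx B *m u
      - cmx (A ^+ j *m B) *m (d ^+ (e + j) *: v).
Proof.
elim: j v => [|j IH] v.
  exists 0, (d ^+ (e + 0) *: v).
  by rewrite scaler0 mulmx0 add0r expr0 mul1mx subrr raddf0.
pose v' := ((e + j).+1%:R * d^`()) *: v + d *: dmx v.
have [h [u hu]] := IH v'.
exists (h + d ^+ j.+1 *: (cmx (A ^+ j *m B) *m v)), u.
have dv : dmx (d ^+ (e + j.+1) *: v) = d ^+ (e + j) *: v'.
  by rewrite addnS dmx_expZ.
rewrite scalerDr scalerA -exprD.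
have -> : d ^+ (e + j.+1) *: (cmx (A ^+ j *m B) *m v) =
          cmx (A ^+ j *m B) *m (d ^+ (e + j.+1) *: v) by rewrite scalemxAr.
rewrite raddfD /= hu dmx_mul_cst dv mulmxDr mulmxA -map_mxM mulmxA.
have -> : A ^+ j.+1 = A *m A ^+ j by rewrite exprS.
rewrite subrK.
by rewrite addrAC addrK.
Qed.

(** The witness is the Taylor polynomial of degree e of exp ((t - s) A) x. *)
Lemma truncated_flow (K : realFieldType) (n : nat) (A : 'M[K]_n)
    (x : 'cV[K]_n) (s : K) (e : nat) :
  exists2 a : 'cV[{poly K}]_n,
    dmx a = cmx A *m a
      - ((e`!%:R^-1)%:P * ('X - s%:P) ^+ e) *: cmx (A ^+ e.+1 *m x)
    & map_mx (horner_eval s) a = x.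
Proof.
elim: e => [|e [a aD aE]].
  exists (cmx x).
    by rewrite dmx_cst fact0 invr1 expr0 mulr1 scale1r expr1 map_mxM subrr.
  by apply/matrixP => i j; rewrite !mxE /horner_eval hornerC.
exists (a + ((e.+1`!%:R^-1)%:P * ('X - s%:P) ^+ e.+1) *: cmx (A ^+ e.+1 *m x)).
  rewrite raddfD /= aD dmxZ dmx_cst scaler0 addr0 mulmxDr -scalemxAr.
  have -> : A ^+ e.+2 = A *m A ^+ e.+1 by rewrite exprS.
  rewrite -mulmxA !map_mxM.
  rewrite addrK derivM derivC mul0r add0r.
  rewrite deriv_exp derivXsubC mul1r /= -[_ ^+ e *+ _]mulr_natl.
  have -> : (((e.+1)`!)%:R^-1)%:P * (e.+1%:R * ('X - s%:P) ^+ e) =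
       ((e`!)%:R^-1)%:P * ('X - s%:P) ^+ e :> {poly K}.
    rewrite mulrA; congr (_ * _); rewrite -polyC_natr -polyCM; congr (_%:P).
    by rewrite factS natrM invfM mulrAC mulVf ?mul1r// pnatr_eq0.
  by rewrite subrK.
rewrite raddfD /= aE [X in _ + X](_ : _ = 0) ?addr0//.
apply/matrixP => i j; rewrite !mxE /horner_eval hornerM hornerM horner_exp.
by rewrite hornerXsubC subrr expr0n /= mulr0 mul0r.
Qed.

(** A polynomial q which is flat at both ends, with value 1 at s and 0 at t; it
    comes from a Bezout relation between powers of X - s and X - t. *)
Lemma cutoff (K : fieldType) (s t : K) (e : nat) : s != t ->
  exists q y0 y1 y : {poly K},
    [/\ q = ('X - t%:P) ^+ e.+1 * y1, 1 - q = ('X - s%:P) ^+ e.+1 * y0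
      & q^`() = (('X - s%:P) * ('X - t%:P)) ^+ e * y].
Proof.
move=> st; have cp : coprimep ('X - s%:P) ('X - t%:P).
  by rewrite coprimep_XsubC root_XsubC eq_sym.
have := coprimep_expl e.+1 (coprimep_expr e.+1 cp).
move=> /Bezout_eq1_coprimepP[[u v] /= uv].
exists (v * ('X - t%:P) ^+ e.+1), u, v.
have q1 : 1 - v * ('X - t%:P) ^+ e.+1 = u * ('X - s%:P) ^+ e.+1.
  by rewrite -uv addrK.
have dvd0 : ('X - s%:P) ^+ e %| (v * ('X - t%:P) ^+ e.+1)^`().
  rewrite -[_^`()]opprK -[- _^`()]add0r -(derivC 1) -derivB q1.
  rewrite derivM deriv_exp derivXsubC mul1r /= exprSr dvdpNr.
  apply: dvdp_add; first by apply: dvdp_mull; apply: dvdp_mulr.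
  by rewrite -mulr_natl; do 2!apply: dvdp_mull.
have dvd1 : ('X - t%:P) ^+ e %| (v * ('X - t%:P) ^+ e.+1)^`().
  rewrite derivM deriv_exp derivXsubC mul1r /= exprSr.
  apply: dvdp_add; first by apply: dvdp_mull; apply: dvdp_mulr.
  by rewrite -mulr_natl; do 2!apply: dvdp_mull.
have /dvdpP[y qy] : (('X - s%:P) * ('X - t%:P)) ^+ e %|
    (v * ('X - t%:P) ^+ e.+1)^`().
  by rewrite exprMn Gauss_dvdp ?dvd0// coprimep_expl// coprimep_expr.
by exists y; split; [rewrite mulrC|rewrite q1 mulrC|rewrite qy mulrC].
Qed.

(** With a and c the truncated flows through x0 at s and through x1 at t, the
    curve q a + (1 - q) c solves the equation up to an error divisible by
    d^(n+1), where d = (X - s)(X - t).  The Gramian writes this error as a sum of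
    vectors A^j B w_j with j < n, and [krylov_solve] corrects each of them by a
    function that vanishes at s and t. *)
Lemma polynomial_steering (K : realFieldType) (n r : nat) (A : 'M[K]_n)
    (B : 'M[K]_(n, r)) (s t : K) (x0 x1 : 'cV[K]_n) :
  kalman A B -> s != t ->
  exists (x : 'cV[{poly K}]_n) (u : 'cV[{poly K}]_r),
    [/\ dmx x = cmx A *m x + cmx B *m u,
        map_mx (horner_eval s) x = x0 & map_mx (horner_eval t) x = x1].
Proof.
move=> /kalman_gramian uG st.
have [q [y0 [y1 [y [qE q1E dqE]]]]] := cutoff n.+1 st.
have [a aD a0] := truncated_flow A x0 s n.+1.
have [c cD c1] := truncated_flow A x1 t n.+1.
pose d := ('X - s%:P) * ('X - t%:P).
pose x := q *: a + (1 - q) *: c.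
have [g gE] : exists g, dmx x = cmx A *m x + d ^+ n.+1 *: g.
  pose k : {poly K} := ((n.+1`!)%:R^-1)%:P.
  exists (y *: (a - c)
    - (('X - t%:P) * y1 * k) *: cmx (A ^+ n.+2 *m x0)
    - (('X - s%:P) * y0 * k) *: cmx (A ^+ n.+2 *m x1)).
  have hq : q * (k * ('X - s%:P) ^+ n.+1) = d ^+ n.+1 * (('X - t%:P) * y1 * k).
    by rewrite qE exprMn [_ ^+ n.+2]exprS; ring.
  have hq' : (1 - q) * (k * ('X - t%:P) ^+ n.+1) =
             d ^+ n.+1 * (('X - s%:P) * y0 * k).
    by rewrite q1E exprMn [_ ^+ n.+2]exprS; ring.
  rewrite /x raddfD /= !dmxZ derivB derivC sub0r dqE aD cD -/d -/k.
  rewrite mulmxDr -!scalemxAr.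
  rewrite [q *: (_ - _)]scalerBr [(1 - q) *: (_ - _)]scalerBr !scalerA hq hq'.
  move: (cmx A *m a) (cmx A *m c) (cmx (A ^+ n.+2 *m x0)) => Aa Ac w0.
  move: (cmx (A ^+ n.+2 *m x1)) (k) (d) => w1 k' d'.
  by apply/matrixP => i j; rewrite !mxE; ring.
(* The identity is \sum_j A^j B U_j, by invertibility of the Gramian. *)
pose U (j : 'I_n) := (A ^+ j *m B)^T *m invmx (gramian A B).
have sumU : \sum_(j < n) (A ^+ j *m B) *m U j = 1%:M.
  by rewrite -(mulmxV uG) mulmx_suml; apply: eq_bigr => j _; rewrite !mulmxA.
have hu (j : 'I_n) := krylov_solve A B d j 1 (d ^+ (n - j) *: (cmx (U j) *m g)).
have /choice [h /choice [u huE]] := hu.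
exists (x + \sum_j d *: h j), (\sum_j u j).
have d0 : horner_eval s d = 0.
  by rewrite /horner_eval hornerM hornerXsubC subrr mul0r.
have d1 : horner_eval t d = 0.
  by rewrite /horner_eval hornerM [X in _ * X]hornerXsubC subrr mulr0.
have q0 : horner_eval s q = 1.
  apply/eqP; rewrite eq_sym -subr_eq0 -(rmorph1 (horner_eval s)) -rmorphB q1E.
  by rewrite rmorphM rmorphXn /= /horner_eval hornerXsubC subrr expr0n mul0r.
have q1 : horner_eval t q = 0.
  by rewrite qE rmorphM rmorphXn /= /horner_eval hornerXsubC subrr expr0n mul0r.
have evZ (p : nat) z (e : {poly K}) (X : 'cV[{poly K}]_p) :
    map_mx (horner_eval z) (e *: X) = horner_eval z e *: map_mx (horner_eval z) X.
  by rewrite map_mxZ.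
split.
- rewrite raddfD raddf_sum /= gE.
  have huE' (j : 'I_n) : dmx (d *: h j) = cmx A *m (d *: h j) + cmx B *m u j
      - cmx (A ^+ j *m B) *m (d ^+ n.+1 *: (cmx (U j) *m g)).
    have := huE j; rewrite expr1 scalerA -exprD => ->.
    by rewrite -addnA subnKC ?(ltnW (ltn_ord j)).
  rewrite (eq_bigr _ (fun j _ => huE' j)) sumrB big_split /= -!mulmx_sumr.
  have -> : \sum_(j < n) cmx (A ^+ j *m B) *m (d ^+ n.+1 *: (cmx (U j) *m g))
      = d ^+ n.+1 *: g.
    rewrite -[in RHS](mul1mx g) -(map_mx1 (polyC : {rmorphism K -> {poly K}})).
    rewrite -sumU raddf_sum mulmx_suml scaler_sumr; apply: eq_bigr => j _.
    by rewrite /= -scalemxAr; move: (U j) => Uj; rewrite !map_mxM mulmxA.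
  rewrite [cmx A *m (x + _)]mulmxDr -!addrA; congr (_ + _).
  by rewrite addrC -!addrA addNr addr0.
- rewrite raddfD raddf_sum /= raddfD /= !evZ raddfB /= rmorph1 q0 subrr scale1r.
  by rewrite scale0r addr0 a0 big1 ?addr0// => j _;
     rewrite evZ d0 scale0r.
- rewrite raddfD raddf_sum /= raddfD /= !evZ raddfB /= rmorph1 q1 subr0 scale1r.
  by rewrite scale0r add0r c1 big1 ?addr0// => j _;
     rewrite evZ d1 scale0r.
Qed.

(** * Harmonic functions on a leader-follower connected graph *)

Section Graph.
Variables (R : realType) (n : nat) (a : 'M[R]_n) (leaders : {set 'I_n}).
Hypothesis a_graph : weighted_graph a.
Hypothesis conn : leader_follower_connected a leaders.

(** Every agent of S' is reached from the leaders by a path whose agents, except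
    possibly the last one, belong to S; expressed through the sets Z that contain
    the leaders and absorb the neighbours of their elements in S, which is the
    form used with Z the zero set of a harmonic function. *)
Definition anchored (S S' : {set 'I_n}) :=
  forall Z : {set 'I_n}, leaders \subset Z ->
    (forall i j, i \in S -> i \in Z -> 0 < a i j -> j \in Z) -> S' \subset Z.

(** A nonempty set closed under adjacency contains a whole component. *)
Lemma adjacent_closed_leader (Z : {set 'I_n}) (i : 'I_n) :
  (forall j k, j \in Z -> 0 < a j k -> k \in Z) -> i \in Z ->
  exists2 l, l \in leaders & l \in Z.
Proof.
move=> Zcl iZ; have [l lL] := conn i; rewrite inE => il; exists l => //.
have asym : symmetric (adjacent a).
  by case: a_graph => as_ _ _ x y; rewrite /adjacent as_.
have cl : fingraph.closed (adjacent a) (mem Z).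
  apply: intro_closed; first exact: sym_connect_sym.
  by move=> x y xy xZ; exact: Zcl xZ xy.
by rewrite -(closed_connect cl il).
Qed.

Section Harmonic.
Variables (S : {set 'I_n}) (v : 'I_n) (p : 'I_n -> R).
Hypothesis p_supp : forall i, i \notin v |: S -> p i = 0.
Hypothesis p_leaders : forall i, i \in leaders -> p i = 0.
Hypothesis p_harm : forall i, i \in S -> \sum_j a i j * (p i - p j) = 0.

(** Minimum principle: were the minimum of p negative, the set where it is
    attained would be contained in S and closed under adjacency, by harmonicity,
    and would thus contain a leader, where p is zero. *)
Lemma harmonic_ge0 : 0 <= p v -> forall i, 0 <= p i.
Proof.
move=> pv i; have [_ a_ge0 _] := a_graph.
case: (@Order.TotalTheory.arg_minP _ _ _ i xpredT p isT) => i0 _ i0min.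
apply: le_trans (i0min i isT); rewrite leNgt; apply/negP => pi0.
pose Z := [set j | p j == p i0]%SET.
have [||l lL] := @adjacent_closed_leader Z i0; last first.
  by rewrite inE p_leaders// eq_sym lt_eqF.
  by rewrite inE.
move=> j k; rewrite !inE => /eqP pj ajk.
have jS : j \in S.
  have : j \in v |: S.
    by apply: contraT => /p_supp pj0; rewrite -pj pj0 ltxx in pi0.
  by case/setU1P => // jv; rewrite -pj jv ltNge pv in pi0.
(* At a minimum every term a_jl (p_l - p_j) is nonnegative. *)
have := p_harm jS => /eqP; rewrite -oppr_eq0 -sumrN psumr_eq0 => [/allP|l _].
  move=> /(_ k (mem_index_enum _)); rewrite oppr_eq0 mulf_eq0 gt_eqF//=.
  by rewrite subr_eq0 pj eq_sym.
by rewrite -mulrN opprB mulr_ge0// subr_ge0 pj i0min.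
Qed.

(** As p is nonnegative, each zero of p in S is a minimum, so that its neighbours
    are zeros too; zeros therefore spread from the leaders to S and v. *)
Lemma harmonic_eq0_of_ge0 : anchored S (v |: S) -> 0 <= p v -> forall i, p i = 0.
Proof.
move=> anc pv; have p_ge0 := harmonic_ge0 pv; have [_ a_ge0 _] := a_graph.
have /fintype.subsetP sub : v |: S \subset [set j | p j == 0]%SET.
  apply: anc; first by apply/fintype.subsetP => l lL; rewrite inE p_leaders.
  move=> i j iS; rewrite !inE => /eqP pi0 aij.
  have := p_harm iS => /eqP; rewrite -oppr_eq0 -sumrN psumr_eq0 => [/allP|k _].
    move=> /(_ j (mem_index_enum _)); rewrite oppr_eq0 mulf_eq0 gt_eqF//=.
    by rewrite pi0 sub0r oppr_eq0.
  by rewrite -mulrN opprB pi0 subr0 mulr_ge0.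
move=> i; have [/sub|/p_supp//] := boolP (i \in v |: S).
by rewrite inE => /eqP.
Qed.

End Harmonic.

Lemma harmonic_eq0 (S : {set 'I_n}) (v : 'I_n) (p : 'I_n -> R) :
  (forall i, i \notin v |: S -> p i = 0) ->
  (forall i, i \in leaders -> p i = 0) ->
  (forall i, i \in S -> \sum_j a i j * (p i - p j) = 0) ->
  anchored S (v |: S) -> forall i, p i = 0.
Proof.
move=> p1 p2 p3 anc; have [pv|pv] := leP 0 (p v).
  exact: (harmonic_eq0_of_ge0 p1 p2 p3 anc pv).
move=> i; apply/eqP; rewrite -oppr_eq0; apply/eqP; move: i.
apply: (@harmonic_eq0_of_ge0 S v (fun i => - p i)) => //.
- by move=> i /p1 ->; rewrite oppr0.
- by move=> i /p2 ->; rewrite oppr0.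
- move=> i iS; have /(congr1 -%R) := p3 i iS; rewrite oppr0 -sumrN.
  by apply: etrans; apply: eq_bigr => j _;
     ring.
- by rewrite oppr_ge0 ltW.
Qed.

(** Take a leader outside S if there is one; otherwise the complement of S
    contains no leader, so it is not closed under adjacency and an edge leaves S. *)
Lemma grow (S : {set 'I_n}) : anchored S S -> S != [set: 'I_n]%SET ->
  exists2 v, v \notin S & anchored S (v |: S).
Proof.
move=> anc SnT.
have [/fintype.subsetP lS|/subsetPn[l lL lS]] := boolP (leaders \subset S); last first.
  exists l => // Z LZ cl; rewrite finset.subUset finset.sub1set (fintype.subsetP LZ)//=.
  exact: anc.
have [/existsP[v /andP[vS /existsP[u /andP[uS auv]]]]|] :=
    boolP [exists v, (v \notin S) && [exists u, (u \in S) && (0 < a u v)]].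
  exists v => // Z LZ cl; have SZ := anc Z LZ cl.
  by rewrite finset.subUset SZ andbT finset.sub1set (cl u)// (fintype.subsetP SZ).
move=> /existsPn noedge; exfalso; move/negP: SnT; apply.
rewrite -finset.subTset; apply/fintype.subsetP => i _; apply: contraT => iS.
have [||l lL] := @adjacent_closed_leader (~: S) i; last first.
  by rewrite inE lS.
  by rewrite inE.
move=> j k; rewrite !inE => jS ajk; apply/negP => kS.
have := noedge j; rewrite jS /= => /existsPn /(_ k); rewrite kS /=.
by case: a_graph => -> _ _; rewrite ajk.
Qed.

End Graph.

(** * Choice of the gains *)

Section Network.
Variables (R : realType) (n : nat) (m : 'I_n -> nat).
Variables (a : 'M[R]_n) (leaders : {set 'I_n}).
Local Notation dim := (\sum_i m i)%N.

Definition first_vec (d : nat) : 'cV[R]_d := \col_(i < d) (i == 0%N :> nat)%:R.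

Definition laplacian : 'M[R]_n :=
  \matrix_(i, j) ((i == j)%:R * (\sum_k a i k) - a i j).

Definition chains : 'M[R]_dim := \mxdiag_i companion (0 : 'cV[R]_(m i)).

(** The coupling enters each chain of integrators through its last coordinate,
    and only the first coordinate of each chain is fed back. *)
Definition tails : 'M[R]_(dim, n) := \mxcol_i (last_vec R (m i) *m delta_mx 0 i).

Definition heads : 'M[R]_(n, dim) :=
  \mxrow_j (delta_mx j 0 *m (first_vec (m j))^T).

(** The network in the coordinates T_i x_i, with gains be_i = k_i e_1; the
    companion matrix of 0 is the nilpotent matrix of a chain of integrators. *)
Definition closed_loop (k : 'rV[R]_n) : 'M[R]_dim :=
  chains - tails *m laplacian *m diag_mx k *m heads.

Definition leader_inputs : 'M[R]_(dim, n) :=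
  tails *m diag_mx (\row_i (i \in leaders)%:R).

(** Additional inputs, one for each coordinate of the agents outside S. *)
Definition free_inputs (S : {set 'I_n}) : 'M[R]_dim :=
  \mxdiag_i (((i \notin S)%:R)%:M : 'M[R]_(m i)).

Lemma row_chains (w : 'rV[R]_dim) i :
  submxrow (w *m chains) i = submxrow w i *m companion (0 : 'cV[R]_(m i)).
Proof. by rewrite -{1}[w]submxrowK mul_mxrow_mxdiag mxrowK. Qed.

Lemma row_free_inputs (w : 'rV[R]_dim) S i :
  submxrow (w *m free_inputs S) i = (i \notin S)%:R *: submxrow w i.
Proof. by rewrite -{1}[w]submxrowK mul_mxrow_mxdiag mxrowK mul_mx_scalar. Qed.

Lemma row_tails (w : 'rV[R]_dim) i :
  (w *m tails) 0 i = (submxrow w i *m last_vec R (m i)) 0 0.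
Proof.
rewrite -{1}[w]submxrowK mul_mxrow_mxcol summxE (bigD1 i)//= big1 => [|j ji].
  by rewrite addr0 mulmxA mxE big_ord1 [X in _ * X]mxE !eqxx mulr1.
by rewrite mulmxA mxE big_ord1 [X in _ * X]mxE (eq_sym i) (negPf ji) andbF mulr0.
Qed.

Lemma row_heads (w : 'rV[R]_n) i :
  submxrow (w *m heads) i = w 0 i *: (first_vec (m i))^T.
Proof.
rewrite mul_mxrow mxrowK mulmxA; apply/rowP => j.
rewrite [RHS]mxE mxE big_ord1; congr (_ * _).
rewrite mxE (bigD1 i)//= big1 => [|k ki]; rewrite mxE ?eqxx ?mulr1 ?addr0//.
by rewrite (negPf ki) mulr0.
Qed.

Lemma col_chains (z : 'cV[R]_dim) i :
  submxcol (chains *m z) i = companion (0 : 'cV[R]_(m i)) *m submxcol z i.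
Proof. by rewrite -{1}[z]submxcolK mul_mxdiag_mxcol mxcolK. Qed.

Lemma col_tails (u : 'cV[R]_n) i :
  submxcol (tails *m u) i = u i 0 *: last_vec R (m i).
Proof.
rewrite mxcol_mul mxcolK -mulmxA; apply/colP => j.
rewrite [RHS]mxE mxE big_ord1 mulrC; congr (_ * _).
rewrite mxE (bigD1 i)//= big1 => [|k ki]; rewrite mxE ?eqxx ?mul1r ?addr0//.
by rewrite (negPf ki) andbF mul0r.
Qed.

Lemma col_heads (z : 'cV[R]_dim) i :
  (heads *m z) i 0 = dotv (first_vec (m i)) (submxcol z i).
Proof.
rewrite -{1}[z]submxcolK mul_mxrow_mxcol summxE (bigD1 i)//= big1 => [|j ji].
  rewrite addr0 -mulmxA mxE big_ord1 [X in X * _]mxE !eqxx mul1r.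
  by rewrite /dotv.
by rewrite -mulmxA mxE big_ord1 [X in X * _]mxE (eq_sym i) (negPf ji) mul0r.
Qed.


Lemma row_closed_loop k (w : 'rV[R]_dim) i :
  submxrow (w *m closed_loop k) i =
    submxrow w i *m companion (0 : 'cV[R]_(m i))
    - (w *m tails *m laplacian *m diag_mx k) 0 i *: (first_vec (m i))^T.
Proof. by rewrite mulmxBr submxrowB row_chains !mulmxA row_heads. Qed.

End Network.

Lemma companion0_exp (R : realType) (d : nat) (j : nat) :
  companion (0 : 'cV[R]_d) ^+ j = \matrix_(r, s) ((s : nat) == r + j)%N%:R.
Proof.
elim: j => [|j IH].
  rewrite expr0; apply/matrixP => r s; rewrite !mxE addn0 eq_sym.
  by rewrite -val_eqE.
rewrite exprS IH -[_ * _]/(_ *m _); apply/matrixP => r s; rewrite !mxE.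
have [rd|dr] := ltnP r.+1 d.
  rewrite (bigD1 (Ordinal rd))//= big1 => [|t tr].
    by rewrite !mxE /= ltn_eqF// eqxx mul1r addr0 addSnnS.
  rewrite !mxE /= ltn_eqF// [_ == _](_ : _ = false) ?mul0r//.
  by apply: contraNF tr => /eqP tr; apply/eqP/val_inj.
have rE : r.+1 = d by apply/eqP; rewrite eqn_leq dr ltn_ord.
rewrite big1 => [|t _]; last by rewrite !mxE rE eqxx mul0r.
rewrite [_ == _](_ : _ = false)//; apply/negbTE.
by rewrite neq_ltn addnS -addSn rE (leq_trans (ltn_ord s)) ?leq_addr.
Qed.

Lemma companion0_nilpotent (R : realType) (d j : nat) : (d <= j)%N ->
  companion (0 : 'cV[R]_d) ^+ j = 0.
Proof.
move=> dj; rewrite companion0_exp; apply/matrixP => r s; rewrite !mxE.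
by rewrite ltn_eqF// (leq_trans (ltn_ord s))// (leq_trans dj) ?leq_addl.
Qed.

(** The last basis vector spans the left kernel of the nilpotent chain. *)
Lemma companion0_ker (R : realType) (d : nat) (w : 'rV[R]_d) :
  w *m companion (0 : 'cV[R]_d) = 0 -> (w *m last_vec R d) 0 0 = 0 -> w = 0.
Proof.
move=> wN wl; apply/rowP => s; rewrite mxE.
have [sd|ds] := ltnP s.+1 d.
  move/rowP/(_ (Ordinal sd)): wN; rewrite -[companion _]expr1 companion0_exp.
  rewrite !mxE (bigD1 s)//= big1 => [|t ts]; first by rewrite mxE addn1 eqxx mulr1 addr0.
  rewrite mxE /= addn1 eqSS [_ == _](_ : _ = false) ?mulr0//.
  by rewrite eq_sym; apply/negbTE.
move: wl; rewrite mxE (bigD1 s)//= big1 => [|t ts].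
  by rewrite mxE eqn_leq ds ltn_ord mulr1 addr0.
rewrite mxE [_ == _](_ : _ = false) ?mulr0//; apply/negbTE.
apply: contra ts => /eqP td; apply/eqP/val_inj/eqP.
by rewrite -eqSS td eqn_leq ds ltn_ord.
Qed.

Section Gains.
Variables (R : realType) (n : nat) (m : 'I_n -> nat).
Hypothesis m_gt0 : forall i, (0 < m i)%N.
Variables (a : 'M[R]_n) (leaders : {set 'I_n}).
Hypothesis a_graph : weighted_graph a.
Hypothesis conn : leader_follower_connected a leaders.
Local Notation dim := (\sum_i m i)%N.
Local Notation F := (closed_loop m a).
Local Notation B := (leader_inputs R m leaders).
Local Notation free := (free_inputs R m).

Lemma row_laplacian (p : 'rV[R]_n) i :
  (p *m laplacian a) 0 i = \sum_j a i j * (p 0 i - p 0 j).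
Proof.
rewrite mxE; under eq_bigr => j _ do rewrite mxE mulrBr.
rewrite sumrB (bigD1 i)//= [X in _ + X - _]big1 => [|j ji]; last first.
  by rewrite (negPf ji) mul0r mulr0.
rewrite addr0 eqxx mul1r mulr_sumr -sumrB; apply: eq_bigr => j _.
by case: a_graph => -> _ _; ring.
Qed.

(** The nilpotent part of F has a zero column at the first coordinate of each
    chain, so that only the feedback is seen there: w F = 0 gives
    k_i (L p)_i = 0 for the Laplacian L, where p collects the last components
    of w.  So p is harmonic on S, and it vanishes at the leaders because
    w B = 0. *)
Lemma invariant_functional_eq0 (S : {set 'I_n}) v (k : 'rV[R]_n) (w : 'rV[R]_dim) :
  (forall i, i \in S -> k 0 i != 0) -> anchored a leaders S (v |: S) ->
  (forall i, i \notin v |: S -> submxrow w i = 0) ->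
  w *m B = 0 -> w *m F k = 0 -> w = 0.
Proof.
move=> kS anc supp wB wF; pose p := w *m tails R m.
have blocks i : submxrow w i *m companion (0 : 'cV[R]_(m i)) =
    (p *m laplacian a *m diag_mx k) 0 i *: (first_vec R (m i))^T.
  by apply/eqP; rewrite -subr_eq0 -row_closed_loop wF submxrow0.
have coef i : (p *m laplacian a *m diag_mx k) 0 i = 0.
  have i0 := m_gt0 i.
  have /(congr1 (fun x : 'rV_(m i) => x 0 (Ordinal i0))) := blocks i.
  rewrite mxE big1 => [|j _]; first by rewrite !mxE /= mulr1 => <-.
  by rewrite !mxE /= if_same mulr0.
have ker i : submxrow w i *m companion (0 : 'cV[R]_(m i)) = 0.
  by rewrite blocks coef scale0r.
have harm i : i \in S -> \sum_j a i j * (p 0 i - p 0 j) = 0.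
  move=> iS; rewrite -row_laplacian; have /eqP := coef i.
  by rewrite mul_mx_diag mxE mulf_eq0 (negPf (kS i iS)) orbF => /eqP.
have plead i : i \in leaders -> p 0 i = 0.
  move=> iL; have /rowP/(_ i) := wB.
  by rewrite /leader_inputs mulmxA mul_mx_diag !mxE iL mulr1 -/p.
have psupp i : i \notin v |: S -> p 0 i = 0.
  by move=> /supp wi; rewrite row_tails wi mul0mx mxE.
have p0 := harmonic_eq0 a_graph conn psupp plead harm anc.
apply/mxrowP => i; rewrite submxrow0; apply: companion0_ker => //.
by rewrite -row_tails; exact: p0.
Qed.

(** Withdraws the additional inputs of agent v while its gain is still zero. *)
Lemma kalman_extend (S : {set 'I_n}) v (k : 'rV[R]_n) :
  (forall i, (k 0 i != 0) = (i \in S)) -> v \notin S ->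
  anchored a leaders S (v |: S) ->
  kalman (F k) (row_mx B (free S)) -> kalman (F k) (row_mx B (free (v |: S))).
Proof.
move=> kS vS anc kal w H.
have wB j : w *m F k ^+ j *m B = 0.
  by have := H j; rewrite mul_mx_row -row_mx0 => /eq_row_mx[].
have supp j i : i \notin v |: S -> submxrow (w *m F k ^+ j) i = 0.
  move=> iS; have := H j; rewrite mul_mx_row -row_mx0 => /eq_row_mx[_].
  move=> /(congr1 (fun x => submxrow x i)).
  by rewrite row_free_inputs iS scale1r submxrow0.
have powv j : submxrow (w *m F k ^+ j) v
    = submxrow w v *m companion (0 : 'cV[R]_(m v)) ^+ j.
  elim: j => [|j IH]; first by rewrite !expr0 !mulmx1.
  rewrite !exprSr -[_ * F k]/(_ *m F k) mulmxA row_closed_loop IH.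
  have /negbFE/eqP kv : (k 0 v != 0) = false by rewrite kS (negPf vS).
  by rewrite mul_mx_diag mxE kv mulr0 scale0r subr0 -mulmxA.
(* After m v steps the component of w at v has left its chain. *)
have nil : w *m F k ^+ (m v) = 0.
  apply: kal => j.
  have -> : w *m F k ^+ m v *m F k ^+ j = w *m F k ^+ (m v + j).
    by rewrite -mulmxA exprD.
  rewrite mul_mx_row wB -row_mx0; congr row_mx.
  apply/mxrowP => i; rewrite row_free_inputs submxrow0.
  have [->|iv] := eqVneq i v.
    by rewrite powv companion0_nilpotent ?leq_addr// mulmx0 scaler0.
  have [iS|iS] := boolP (i \in S); first by rewrite scale0r.
  by rewrite supp ?scaler0// !inE negb_or iv.
have ex : exists j, w *m F k ^+ j == 0 by exists (m v); rewrite nil.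
case: (ex_minnP ex) => -[|j] /eqP wj jmin; first by rewrite expr0 mulmx1 in wj.
have /jmin : w *m F k ^+ j == 0; last by rewrite ltnn.
apply/eqP; apply: (@invariant_functional_eq0 S v k) => //.
- by move=> i iS; rewrite kS.
- exact: supp.
- by rewrite -wj exprSr -[_ * F k]/(_ *m F k) mulmxA.
Qed.

Lemma exists_gains : exists k, kalman (F k) B.
Proof.
(* Induction on the number d of agents that still have additional inputs. *)
suff gen d : forall (S : {set 'I_n}) (k : 'rV[R]_n), #|~: S| = d ->
    (forall i, (k 0 i != 0) = (i \in S)) -> anchored a leaders S S ->
    kalman (F k) (row_mx B (free S)) -> exists k, kalman (F k) B.
  apply: (gen _ finset.set0 0 erefl).
  - by move=> i; rewrite mxE eqxx inE.
  - by move=> Z _ _; rewrite finset.sub0set.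
  - move=> w /(_ 0%N); rewrite expr0 mulmx1 mul_mx_row -row_mx0.
    move=> /eq_row_mx[_ w0]; apply/mxrowP => i; rewrite submxrow0.
    have := row_free_inputs w finset.set0 i.
    by rewrite w0 submxrow0 inE scale1r => <-.
elim: d => [|d IH] S k cS kS anc kal.
  exists k => w H; apply: kal => j; rewrite mul_mx_row H -row_mx0; congr row_mx.
  apply/mxrowP => i; rewrite row_free_inputs submxrow0.
  have -> : i \in S.
    by have /eqP := cS; rewrite cards_eq0 => /eqP/setP/(_ i); rewrite !inE => /negbFE.
  by rewrite scale0r.
have SnT : S != [set: 'I_n]%SET.
  by apply/eqP => ST; move: cS; rewrite ST finset.setCT cards0.
have [v vS ancv] := grow a_graph conn anc SnT.
have kal' := kalman_extend kS vS ancv kal.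
pose H : 'M[R]_dim := - (tails R m *m laplacian a *m diag_mx (delta_mx 0 v) *m heads R m).
have [e e0 kal''] := kalman_perturb H kal'.
apply: (IH (v |: S) (k + e *: delta_mx 0 v)).
- apply/eqP; rewrite -eqSS -cS finset.setCU finset.setIC -finset.setDE.
  by rewrite [X in _ == X](cardsD1 v) !inE vS.
- move=> i; rewrite !mxE !inE eqxx /= -kS.
  have [->|iv] := eqVneq i v; last by rewrite mulr0 addr0.
  have /negbFE/eqP -> : (k 0 v != 0) = false by rewrite kS (negPf vS).
  by rewrite add0r mulr1 e0.
- move=> Z LZ cl; apply: ancv => // i j iS; apply: cl.
  by rewrite inE iS orbT.
- have -> : F (k + e *: delta_mx 0 v) = F k + e *: H; last by [].
  rewrite /closed_loop /H scalerN -addrA -opprD; congr (_ - _).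
  by rewrite !linearD /= linearZ /= mulmxDl -scalemxAr -scalemxAl.
Qed.

End Gains.

(** * Linear equations with finitely many exceptional times *)

(** By induction on the exceptional times, cutting the interval at one of them. *)
Lemma nonincreasing_piecewise (R : realType) (s : seq R) (a b : R) (f g : R -> R) :
  a <= b -> {within `[a, b], continuous f} ->
  (forall t, a < t < b -> t \notin s -> is_derive t (1 : R) f (g t)) ->
  (forall t, a < t < b -> t \notin s -> g t <= 0) ->
  f b <= f a.
Proof.
elim: s a b => [|c s IH] a b ab fc fd g0.
  apply: (@ler0_derive1_le_cc R f a b); rewrite ?in_itv /= ?lexx ?ab//.
  - by move=> x; rewrite in_itv /= => xab; have [] := fd x xab isT.
  - move=> x; rewrite in_itv /= => xab; rewrite derive1E.
    by have [_ ->] := fd x xab isT; exact: g0.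
have [/andP[ac cb]|/negP cab] := boolP (a < c < b); last first.
  apply: IH => // t tab ts; [apply: fd|apply: g0] => //;
    rewrite inE negb_or ts andbT; by apply: contra_notN cab => /eqP <-.
apply: (@le_trans _ _ (f c)).
  apply: (IH c b) => [||t /andP[ct tb] ts|t /andP[ct tb] ts].
  - exact: ltW.
  - apply: continuous_subspaceW fc; apply: subset_itvr.
    by rewrite bnd_simp ltW.
  - by apply: fd; rewrite ?(lt_trans ac ct) ?tb// inE negb_or ts gt_eqF.
  - by apply: g0; rewrite ?(lt_trans ac ct) ?tb// inE negb_or ts gt_eqF.
apply: (IH a c) => [||t /andP[ct tb] ts|t /andP[ct tb] ts].
- exact: ltW.
- apply: continuous_subspaceW fc; apply: subset_itvl.
  by rewrite bnd_simp ltW.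
- by apply: fd; rewrite ?(lt_trans tb cb) ?ct// inE negb_or ts lt_eqF.
- by apply: g0; rewrite ?(lt_trans tb cb) ?ct// inE negb_or ts lt_eqF.
Qed.

Lemma constant_piecewise (R : realType) (s : seq R) (a b : R) (f g : R -> R) :
  a <= b -> {within `[a, b], continuous f} ->
  (forall t, a < t < b -> t \notin s -> is_derive t (1 : R) f (g t)) ->
  (forall t, a < t < b -> t \notin s -> g t = 0) ->
  f b = f a.
Proof.
move=> ab fc fd g0; apply/eqP; rewrite eq_le; apply/andP; split.
  by apply: (nonincreasing_piecewise ab fc fd) => t tab ts; rewrite (g0 t tab ts).
rewrite -lerN2.
apply: (@nonincreasing_piecewise R s a b (- f) (- g)) => //.
- by move=> x; apply: continuousN; exact: fc.
- by move=> t tab ts; apply: is_deriveN; exact: fd.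
- by move=> t tab ts; rewrite fctE (g0 t tab ts) oppr0.
Qed.

Lemma is_derive_mxP (R : realType) (p : nat) (x : R -> 'cV[R]_p) (t : R)
    (v : 'cV[R]_p) :
  is_derive t (1 : R) x v <->
  forall i, is_derive t (1 : R) (fun s => x s i 0) (v i 0).
Proof.
split=> [[xd xv] i|H].
  split; first exact: (derivable_mxP _ _ _).1.
  by rewrite -xv derive_mx// mxE.
have xd : derivable x t (1 : R).
  by apply/derivable_mxP => i j; rewrite ord1; have [] := H i.
split => //; rewrite derive_mx//; apply/matrixP => i j; rewrite !mxE ord1.
by have [] := H i.
Qed.

Lemma continuous_for_sum (R : realType) (T : topologicalType) (I : finType)
    (P : pred I) (f : I -> T -> R) (t : T) :
  (forall i, P i -> {for t, continuous (f i)}) ->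
  {for t, continuous (fun s => \sum_(i | P i) f i s)}.
Proof.
move=> fc; rewrite (_ : (fun s => \sum_(i | P i) f i s) = \sum_(i | P i) f i);
  last by apply/funext => s; rewrite fct_sumE.
apply: (big_ind (fun g : T -> R => {for t, continuous g})) => //.
- exact: cst_continuous.
- by move=> g h gc hc; exact: (@continuousD _ _ _ g h t gc hc).
Qed.

Lemma within_continuous_dot (R : realType) (p : nat) (D : set R)
    (c : 'rV[R]_p) (x : R -> 'cV[R]_p) :
  {within D, continuous x} -> {within D, continuous (fun t => (c *m x t) 0 0)}.
Proof.
move=> xc.
apply: (@within_continuous_comp _ _ _ D x (fun v : 'cV[R]_p => (c *m v) 0 0)) xc.
move=> v _; rewrite (_ : (fun v : 'cV[R]_p => (c *m v) 0 0) =
   fun v : 'cV[R]_p => \sum_i c 0 i * v i 0); last first.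
  by apply/funext => u; rewrite mxE.
apply: continuous_for_sum => i _.
apply: (@continuousM _ _ (cst (c 0 i)) (fun u : 'cV[R]_p => u i 0) v).
- exact: cst_continuous.
- exact: coord_continuous.
Qed.

Lemma is_derive_dot (R : realType) (p : nat) (c : 'rV[R]_p)
    (x : R -> 'cV[R]_p) (t : R) (v : 'cV[R]_p) :
  is_derive t (1 : R) x v ->
  is_derive t (1 : R) (fun s => (c *m x s) 0 0) ((c *m v) 0 0).
Proof.
move=> /is_derive_mxP xd.
rewrite (_ : (fun s => (c *m x s) 0 0) = \sum_i (c 0 i *: (fun s => x s i 0)));
  last by apply/funext => s; rewrite mxE fct_sumE.
rewrite mxE; apply: is_derive_sum => i; exact: is_deriveZ.
Qed.

(** Energy estimate: y = P x satisfies y' = M y, so V = |y|^2 satisfies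
    V' <= C V, and e^(-C t) V is nonincreasing, nonnegative and zero at t0. *)
Lemma linear_ode_eq0 (R : realType) (p d : nat) (t0 t1 : R)
    (x f : R -> 'cV[R]_p) (P : 'M[R]_(d, p)) (M : 'M[R]_d) :
  t0 <= t1 -> ode_solution t0 t1 x f ->
  (forall t, P *m f t = M *m (P *m x t)) ->
  P *m x t0 = 0 -> P *m x t1 = 0.
Proof.
move=> t01 [xc [s xd]] Pf Px0.
pose y i t : R := (row i P *m x t) 0 0.
have yE i t : y i t = (P *m x t) i 0 by rewrite /y -row_mul mxE.
pose V t := \sum_i y i t ^+ 2.
pose C := \sum_i \sum_j 2 * `|M i j|.
pose W t := expR (- C * t) * V t.
pose V' t := \sum_i 2 * (y i t * \sum_j M i j * y j t).
have yV i j t : `|y i t * y j t| <= V t.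
  have yi k : y k t ^+ 2 <= V t.
    by rewrite /V (bigD1 k)//= lerDl sumr_ge0// => l _; rewrite sqr_ge0.
  have := yi i; have := yi j; rewrite ler_norml.
  have : 0 <= (y i t + y j t) ^+ 2 by exact: sqr_ge0.
  have : 0 <= (y i t - y j t) ^+ 2 by exact: sqr_ge0.
  by nra.
have V'le t : V' t <= C * V t.
  rewrite /V' /C mulr_suml; apply: ler_sum => i _.
  rewrite [leRHS]mulr_suml [_ * \sum_j _ * y j t]mulr_sumr [leLHS]mulr_sumr.
  apply: ler_sum => j _.
  rewrite -mulrA ler_pM2l// mulrCA (le_trans (ler_norm _))// normrM.
  exact: ler_wpM2l.
have yd i t : t0 < t < t1 -> t \notin s ->
    is_derive t (1 : R) (y i) (\sum_j M i j * y j t).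
  move=> tt ts; have := is_derive_dot (row i P) (xd t tt ts).
  rewrite -row_mul Pf [X in is_derive _ _ _ X]mxE mxE.
  by under eq_bigr do rewrite -yE.
have Wd t : t0 < t < t1 -> t \notin s ->
    is_derive t (1 : R) W (expR (- C * t) * (V' t - C * V t)).
  move=> tt ts.
  have Vd : is_derive t (1 : R) V (V' t).
    rewrite (_ : V = \sum_i (y i ^+ 2)); last first.
      by apply/funext => r; rewrite fct_sumE.
    apply: is_derive_sum => i; have yid := yd i t tt ts.
    apply: (trigger_derive (is_deriveX 2 yid)).
    by rewrite /= expr1 /GRing.scale /= mulrA.
  have ed : is_derive t (1 : R) (fun r => expR (- C * r)) (expR (- C * t) * - C).
    have Cd : is_derive t (1 : R) (fun r : R => - C * r) (- C).
      apply: (trigger_derive (is_deriveZ (- C) (is_derive_id t (1 : R)))).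
      by rewrite /GRing.scale /= mulr1.
    exact: (trigger_derive (is_derive1_comp (is_derive_expR (- C * t)) Cd)).
  apply: (trigger_derive (is_deriveM ed Vd)).
  by rewrite /= /GRing.scale /=; ring.
have V0 : V t0 = 0.
  by rewrite /V big1// => i _; rewrite yE Px0 mxE expr0n.
have W1 : W t1 <= 0.
  have <- : W t0 = 0 by rewrite /W V0 mulr0.
  apply: (nonincreasing_piecewise t01 _ Wd).
    move=> t; apply: (@continuousM _ _
      (fun r : subspace `[t0, t1] => expR (- C * r)) V t).
      apply: continuous_subspaceT => r.
      apply: (@continuous_comp _ _ _ ( *%R (- C)) expR).
        exact: mulrl_continuous.
      exact: continuous_expR.
    apply: continuous_for_sum => i _;
    have yc := @within_continuous_dot R p _ (row i P) x xc.
    exact: (@continuousM _ _ (y i : subspace `[t0, t1] -> R) (y i) t (yc t) (yc t)).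
  move=> t _ _; rewrite mulr_ge0_le0 ?expR_ge0// subr_le0; exact: V'le.
have V1 : V t1 = 0.
  apply/eqP; rewrite eq_le sumr_ge0 ?andbT => [|i _]; last exact: sqr_ge0.
  by move: W1; rewrite /W pmulr_rle0 ?expR_gt0.
apply/colP => i; rewrite -yE [RHS]mxE; apply/eqP; rewrite -sqrf_eq0.
move: V1 => /eqP; rewrite psumr_eq0 => [/allP /(_ i (mem_index_enum _))//|j _].
exact: sqr_ge0.
Qed.

(** * The network *)

Lemma evmx_cmx (K : comNzRingType) (p q : nat) (M : 'M[K]_(p, q)) (t : K) :
  evmx t (cmx M) = M.
Proof. by apply/matrixP => i j; rewrite !mxE /horner_eval hornerC. Qed.

Lemma is_derive_polymx (R : realType) (p : nat) (X : 'cV[{poly R}]_p) (t : R) :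
  is_derive t (1 : R) (fun s => evmx s X) (evmx t (dmx X)).
Proof.
apply/is_derive_mxP => i; rewrite !mxE /=.
rewrite (_ : (fun s => _) = horner (X i 0)); first exact: is_derive_poly.
by apply/funext => s; rewrite mxE.
Qed.

Lemma ode_solution_polymx (R : realType) (p : nat) (t0 t1 : R)
    (X : 'cV[{poly R}]_p) (f : R -> 'cV[R]_p) :
  (forall t, evmx t (dmx X) = f t) -> ode_solution t0 t1 (fun t => evmx t X) f.
Proof.
move=> Xf; split.
  apply: continuous_subspaceT => t; apply: differentiable_continuous.
  by apply/derivable1_diffP; have [] := is_derive_polymx X t.
by exists [::] => t _ _; rewrite -Xf; exact: is_derive_polymx.
Qed.

Lemma piecewise_continuous_horner (R : realType) (t0 t1 : R) (p : {poly R}) :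
  piecewise_continuous t0 t1 (horner p).
Proof.
split.
- by exists [::] => t _ _; exact: continuous_horner.
- move=> t _; apply/cvg_ex; exists p.[t].
  by apply: cvg_at_right_filter; exact: continuous_horner.
- move=> t _; apply/cvg_ex; exists p.[t].
  by apply: cvg_at_left_filter; exact: continuous_horner.
Qed.

Lemma companionE (R : realType) (d : nat) (al : 'cV[R]_d) :
  companion al = companion 0 + last_vec R d *m al^T.
Proof.
apply/matrixP => i j; rewrite !mxE big_ord1 !mxE.
have [id|_] := eqVneq i.+1 d; first by rewrite add0r mul1r.
by rewrite mul0r addr0.
Qed.

(** P reads the trailing coordinates in the controllability decomposition; it is
    nonzero because there is at least one of them. *)
Lemma uncontrollable_annihilator (R : realType) (t0 : R) (d : nat)
    (A : 'M[R]_d) (b : 'cV[R]_d) (T : 'M[R]_d) (al : 'cV[R]_d) :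
  uncontrollable_form t0 A b T al ->
  exists (e : nat) (P : 'M[R]_(e, d)) (M : 'M[R]_e) (y : 'cV[R]_d),
    [/\ P *m A = M *m P, P *m b = 0 & P *m y != 0].
Proof.
case=> uT [c [e [ce]]]; move: A b T al uT; case: d / ce => A b T al uT.
move=> [alc [Abar [Anc [[cd _] TA Tb _]]]].
rewrite !castmx_id in TA Tb.
pose Q : 'M[R]_(e, c + e) := row_mx 0 1%:M.
exists e, (Q *m T), Anc, (invmx T *m col_mx 0 (const_mx 1)); split.
- have -> : Q *m T *m A = Q *m (T *m A *m invmx T) *m T.
    by rewrite -!mulmxA mulVmx// mulmx1.
  rewrite TA mulmxA; congr (_ *m T).
  rewrite mul_row_block !mul0mx !mul1mx add0r mul_mx_row mulmx0 mulmx1.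
  by rewrite ?add0r ?addr0.
- by rewrite -mulmxA Tb mul_row_col mul0mx mulmx0 addr0.
- rewrite mulmxA -(mulmxA Q) mulmxV// mulmx1 mul_row_col mul0mx mul1mx add0r.
  have e0 : (0 < e)%N by rewrite -[X in (X < _)%N]addn0 ltn_add2l in cd.
  apply/eqP => /matrixP /(_ (Ordinal e0) 0) /eqP; rewrite !mxE.
  by rewrite oner_eq0.
Qed.

Lemma tr_last_vec (R : realType) (d : nat) :
  (last_vec R d.+1)^T = delta_mx 0 ord_max.
Proof. by apply/rowP => i; rewrite !mxE eqSS. Qed.

Lemma last_row_companion (R : realType) (d : nat) (al : 'cV[R]_d) :
  (0 < d)%N -> (last_vec R d)^T *m companion al = al^T.
Proof.
case: d al => // d al _; rewrite tr_last_vec -rowE.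
by apply/rowP => j; rewrite !mxE /= eqxx.
Qed.

Lemma last_vec_norm (R : realType) (d : nat) :
  (0 < d)%N -> dotv (last_vec R d) (last_vec R d) = 1.
Proof. by case: d => // d _; rewrite /dotv tr_last_vec -rowE !mxE eqxx. Qed.

Section Network.
Variables (R : realType) (t0 : R) (n : nat) (m : 'I_n -> nat).
Hypothesis m_gt0 : forall i, (0 < m i)%N.
Variables (A : forall i, 'M[R]_(m i)) (b : forall i, 'cV[R]_(m i)).
Variables (a : 'M[R]_n) (leaders : {set 'I_n}).
Hypothesis a_graph : weighted_graph a.
Variables (T : forall i, 'M[R]_(m i)) (al : forall i, 'cV[R]_(m i)).

Lemma protocolE be z w i :
  protocol a leaders T al be z w i = - dotv (al i) (T i *m z i)
  + \sum_j a i j * (dotv (be j) (T j *m z j) - dotv (be i) (T i *m z i))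
  + (if i \in leaders then w i else 0).
Proof.
rewrite /protocol; congr (_ + _ + _); rewrite [RHS](bigID (mem (neighbors a i))) /=.
rewrite [X in _ + X]big1 ?addr0// => j; rewrite inE /adjacent => aij.
have [_ /(_ i j) a_ge0 _] := a_graph.
have -> : a i j = 0 by apply/eqP; move: aij; rewrite lt_def a_ge0 andbT negbK.
by rewrite mul0r.
Qed.

Lemma agents_controllable_necessary :
  (forall i, transform_spec t0 (A i) (b i) (T i) (al i)) ->
  network_controllable t0 A b a leaders T al ->
  forall i, controllable_pair t0 (A i) (b i).
Proof.
move=> spec net i; apply: contrapT => nc.
have [d [P [M [y [PA Pb Py]]]]] := uncontrollable_annihilator ((spec i).2 nc).
pose xs := @eqtype.dfwith _ (fun j => 'cV[R]_(m j)) (fun=> 0) i y.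
have [t1 [uo [be [x [t01 _ xode x0 x1]]]]] := net (fun=> 0) xs.
have := linear_ode_eq0 (P := P) (M := M) (ltW t01) (xode i).
rewrite x0 x1 mulmx0 /xs eqtype.dfwith_in => Py0; case/eqP: Py; apply: Py0 => // t.
by rewrite mulmxDr -scalemxAr Pb scaler0 addr0 !mulmxA PA.
Qed.

Hypothesis form : forall i, controllable_form (A i) (b i) (T i) (al i).

(** The last coordinate of T x integrates the input together with the feedback
    that al compensates. *)
Lemma last_state_deriv i (x : 'cV[R]_(m i)) (u : R) :
  ((last_vec R (m i))^T *m T i *m (A i *m x + u *: b i)) 0 0 =
  dotv (al i) (T i *m x) + u.
Proof.
have [uT TA Tb] := form i.
have TA' : T i *m (A i *m x) = companion (al i) *m (T i *m x).
  by rewrite -TA !mulmxA mulmxKV.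
rewrite mulmxDr -scalemxAr -!mulmxA Tb TA' mulmxA.
rewrite last_row_companion// mxE; congr (_ + _).
rewrite mxE -[X in _ * X]/(dotv _ _) last_vec_norm// mulr1//.
Qed.

(** The conserved quantity is the sum, over a component without leaders, of the
    last coordinates of the T_i x_i; the target b_i0 gives it the value 1. *)
Lemma topology_necessary :
  network_controllable t0 A b a leaders T al ->
  leader_follower_connected a leaders.
Proof.
move=> net i0; apply: contrapT => noleader.
pose C := component a i0.
have CL i : i \in C -> i \notin leaders.
  by move=> iC; apply/negP => iL; apply: noleader; exists i.
have Ccl i j : i \in C -> j \notin C -> a i j = 0.
  rewrite !inE => i0i i0j; have [_ /(_ i j) a_ge0 _] := a_graph.
  apply/eqP; move: a_ge0; rewrite le_eqVlt eq_sym => /orP[//|aij].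
  by case/negP: i0j; apply: (connect_trans i0i); exact: connect1.
have i0C : i0 \in C by rewrite inE connect0.
pose c i : 'rV[R]_(m i) := (last_vec R (m i))^T *m T i.
have [t1 [uo [be [x [t01 _ xode x0 x1]]]]] :=
  net (fun=> 0) (fun i => (i == i0)%:R *: b i).
pose g t := \sum_(i in C) (c i *m x i t) 0 0.
have cb i : (c i *m b i) 0 0 = 1.
  by have [_ _ Tb] := form i; rewrite -mulmxA Tb -[LHS]/(dotv _ _) last_vec_norm.
have g0 : g t0 = 0 by rewrite /g big1// => i _; rewrite x0 mulmx0 mxE.
have g1 : g t1 = 1.
  rewrite /g (bigD1 i0)//= big1 => [|i /andP[_ ii0]].
    by rewrite x1 eqxx scale1r cb addr0.
  by rewrite x1 (negPf ii0) scale0r mulmx0 mxE.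
have /choice[s xd] : forall i, exists s : seq R, forall t, t0 < t < t1 ->
    t \notin s -> is_derive t (1 : R) (x i) (A i *m x i t
      + protocol a leaders T al be (x^~ t) (uo^~ t) i *: b i).
  by move=> i; have [_ [si H]] := xode i; exists si.
pose u t i := protocol a leaders T al be (x^~ t) (uo^~ t) i.
suff gg : g t1 = g t0 by move/eqP: gg; rewrite g0 g1 oner_eq0.
apply: (@constant_piecewise R (flatten [seq s i | i <- enum 'I_n]) t0 t1 g
  (fun t => \sum_(i in C) (dotv (al i) (T i *m x i t) + u t i)) (ltW t01)).
- move=> t; apply: continuous_for_sum => i _.
  exact: (@within_continuous_dot R _ _ (c i) (x i) (xode i).1 t).
- move=> t tt ts; rewrite (_ : g = \sum_(i in C) (fun t => (c i *m x i t) 0 0));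
    last by apply/funext => r; rewrite fct_sumE.
  have id i : is_derive t (1 : R) (fun r => (c i *m x i r) 0 0)
     (dotv (al i) (T i *m x i t) + u t i).
    rewrite -last_state_deriv; apply: is_derive_dot; apply: xd => //.
    apply: contra ts => ts; apply/flatten_mapP; exists i => //.
    by rewrite mem_enum.
  apply: (big_ind2 (fun f d => is_derive t (1 : R) f d)) => //.
  - exact: is_derive_cst.
  - by move=> f1 d1 f2 d2 H1 H2; exact: is_deriveD.
- move=> t _ _.
  pose y i := dotv (be i) (T i *m x i t).
  have -> : \sum_(i in C) (dotv (al i) (T i *m x i t) + u t i) =
      \sum_(i in C) \sum_(j in C) a i j * (y j - y i).
    apply: eq_bigr => i iC.
    rewrite /u protocolE (negPf (CL i iC)) addr0 addrA addrN add0r.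
    rewrite (bigID (mem C))/= [X in _ + X]big1 ?addr0// => j jC.
    by rewrite Ccl// mul0r.
  (* Exchanging i and j changes the sign of the double sum. *)
  set D := \sum_(i in C) _; suff DD : D + D = 0 by lra.
  rewrite /D [X in _ + X]exchange_big /=.
  rewrite -big_split big1// => i _; rewrite -big_split big1// => j _ /=.
  by case: a_graph => -> _ _; ring.
Qed.

Lemma col_laplacian (p : 'cV[R]_n) i :
  (laplacian a *m p) i 0 = \sum_j a i j * (p i 0 - p j 0).
Proof.
rewrite mxE; under eq_bigr => j _ do rewrite mxE mulrBl.
rewrite sumrB (bigD1 i)//= [X in _ + X - _]big1 => [|j ji]; last first.
  by rewrite eq_sym (negPf ji) !mul0r.
rewrite addr0 eqxx mul1r mulr_suml -sumrB; apply: eq_bigr => j _.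
by rewrite mulrBr.
Qed.

Lemma connected_sufficient :
  leader_follower_connected a leaders ->
  network_controllable t0 A b a leaders T al.
Proof.
move=> conn x0 xs.
have [k kal] := exists_gains m_gt0 a_graph conn.
have t01 : t0 != t0 + 1 by rewrite lt_eqF// ltrDl.
have [X [U [XU X0 X1]]] := polynomial_steering
  (\mxcol_i (T i *m x0 i)) (\mxcol_i (T i *m xs i)) kal t01.
pose be i := k 0 i *: first_vec R (m i).
pose Y i : 'cV[{poly R}]_(m i) := cmx (invmx (T i)) *m submxcol X i.
have evY i t : evmx t (Y i) = invmx (T i) *m submxcol (evmx t X) i.
  by rewrite map_mxM evmx_cmx; congr (_ *m _); apply/matrixP => r c; rewrite !mxE.
have unitT i : T i \in unitmx by have [] := form i.
exists (t0 + 1), (fun i => horner (U i 0)), be, (fun i t => evmx t (Y i)).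
split.
- by rewrite ltrDl.
- by move=> i _; exact: piecewise_continuous_horner.
- move=> i; apply: ode_solution_polymx => t.
  have [uT TA Tb] := form i.
  have dX : evmx t (dmx X) = closed_loop m a k *m evmx t X
      + leader_inputs R m leaders *m evmx t U.
    by rewrite XU raddfD /= !map_mxM !evmx_cmx.
  have dY : evmx t (dmx (Y i)) = invmx (T i) *m submxcol (evmx t (dmx X)) i.
    rewrite dmx_mul_cst map_mxM evmx_cmx; congr (_ *m _).
    by apply/matrixP => r c; rewrite !mxE.
  have TY j : T j *m evmx t (Y j) = submxcol (evmx t X) j.
    by rewrite evY mulKVmx.
  apply: (can_inj (mulKmx uT)); rewrite dY mulKVmx// mulmxDr -scalemxAr Tb.
  have -> : T i *m (A i *m evmx t (Y i)) = companion (al i) *m submxcol (evmx t X) i.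
    by rewrite -TY -TA !mulmxA mulmxKV.
  rewrite protocolE TY companionE mulmxDl -mulmxA [(al i)^T *m _]mx11_scalar.
  rewrite mul_mx_scalar -/(dotv _ _) -addrA -scalerDl -!addrA addNKr.
  rewrite dX submxcolD mulmxBl submxcolB col_chains -!mulmxA !col_tails.
  rewrite -addrA; congr (_ + _); rewrite -scaleNr -scalerDl; congr (_ *: _).
  congr (_ + _); last first.
    rewrite mul_diag_mx !mxE /horner_eval.
    by case: ifP => _; rewrite ?mul1r ?mul0r.
  rewrite col_laplacian -sumrN; apply: eq_bigr => j _.
  have kZ l : (diag_mx k *m (heads R m *m evmx t X)) l 0 =
      dotv (be l) (submxcol (evmx t X) l).
    rewrite mul_diag_mx mxE col_heads /be /dotv linearZ /= -scalemxAl.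
    by rewrite [in RHS]mxE.
  by rewrite !kZ TY; ring.
- by move=> i; rewrite evY X0 mxcolK mulKmx.
- by move=> i; rewrite evY X1 mxcolK mulKmx.
Qed.

End Network.

Theorem theorem2 (R : realType) (t0 : R) (n : nat) (m : 'I_n -> nat)
    (m_gt0 : forall i, (0 < m i)%N)
    (A : forall i, 'M[R]_(m i)) (b : forall i, 'cV[R]_(m i))
    (a : 'M[R]_n) (a_graph : weighted_graph a)
    (leaders : {set 'I_n})
    (T : forall i, 'M[R]_(m i)) (al : forall i, 'cV[R]_(m i))
    (T_al : forall i, transform_spec t0 (A i) (b i) (T i) (al i)) :
  network_controllable t0 A b a leaders T al <->
  (forall i, controllable_pair t0 (A i) (b i)) /\
  leader_follower_connected a leaders.
Proof.
split=> [net|[ctr conn]].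
  have ctr := agents_controllable_necessary T_al net.
  split=> //; apply: (topology_necessary m_gt0 a_graph _ net) => i.
  exact: (T_al i).1.
by apply: connected_sufficient => // i; exact: (T_al i).1.
Qed.
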